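(* Let $n_1, n_2 \ge 3$ be odd integers and let $n = n_1 n_2$. Let $\sigma \in S_{n_1}$ and $\gamma \in S_{n_2}$ be permutations of witness-type. Then there exists a permutation $\pi \in S_n$ of witness-type such that $\operatorname{sgn}(\pi) = \operatorname{sgn}(\sigma)\operatorname{sgn}(\gamma)$.
   Context: $S_m$ is the symmetric group of degree $m$, acting on $\mathbb{Z}_m = \mathbb{Z}/m\mathbb{Z} = \{0,1,\ldots,m-1\}$. Permutations act on the right (the image of $x$ under $\pi$ is $x^\pi$) and are composed from left to right. For $m$ odd, let $c = (0,1,\ldots,m-1) \in S_m$, i.e. $x^c = x+1$. For $\sigma \in S_m$, $\operatorname{sgn}(\sigma) = 1$ if $\sigma$ is even and $\operatorname{sgn}(\sigma) = -1$ if $\sigma$ is odd. For $m$ odd, a permutation $\pi \in S_m$ is of witness-type if every element $\tau$ of the coset $\langle c \rangle \pi = \{c^j\pi : 0 \le j \le m-1\}$ (first $c^j$, then $\pi$) has a unique fixed point and every other element of $\{0,1,\ldots,m-1\}$ lies in a cycle of $\tau$ of even length. *)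

(* Defs.v *)
From mathcomp Require Import all_boot all_order all_algebra all_fingroup.
Set Implicit Arguments.
Unset Strict Implicit.
Unset Printing Implicit Defensive.

Definition cyc (m : nat) : 'S_m := perm (@ordS_inj m).

Definition sgn (m : nat) (s : 'S_m) : int := ((-1) ^+ odd_perm s)%R.

(* MathComp permutations compose from left to right, so the right coset
   <[cyc m]> :* pi is {c ^ j * pi}: first c ^ j, then pi. *)
Definition witness_type (m : nat) (pi : 'S_m) : Prop :=
  forall tau : 'S_m, tau \in (<[cyc m]> :* pi)%g ->
    exists x : 'I_m,
      [/\ tau x = x,
          forall y : 'I_m, tau y = y -> y = x
        & forall y : 'I_m, y != x -> ~~ odd #|porbit tau y|].

(* Main.v *)
Require Import Defs.
From mathcomp Require Import all_boot all_order all_algebra all_fingroup.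
From mathcomp Require Import zify.

(** Write the elements of [Z_(n1 n2)] in mixed radix as [a + n1 b]. Translation
    acts on the digit [a] as translation of [Z_n1], and on [b] as a translation
    whose amount depends only on [a] (the carry). Let [pi] apply [sigma] to [a]
    and [gamma] to [b]. Every [tau = c^j pi] then lies over some
    [t1 = c^j sigma] acting on the first digit: a point not over the fixed
    point [a0] of [t1] is in a cycle of length divisible by that of its first
    digit, which is even; on the fibre over [a0], [tau] acts as some
    [c^k gamma]. The sign is [sgn sigma ^ n2 * sgn gamma ^ n1]. *)

Set Implicit Arguments.
Unset Strict Implicit.
Unset Printing Implicit Defensive.

Lemma dvdn_card_porbit (T : finType) (s : {perm T}) (x : T) (n : nat) :
  (s ^+ n)%g x = x -> #|porbit s x| %| n.
Proof.
set d := #|porbit s x| => snx.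
have d_gt0 : 0 < d by apply/card_gt0P; exists x; apply: porbit_id.
have sdx k : iter (k * d) s x = x.
  by elim: k => // k IHk; rewrite mulSn iterD IHk iter_porbit.
move: snx; rewrite permX {1}(divn_eq n d) addnC iterD sdx => srx.
(* The first [d] iterates of [x] are distinct, so the iterates [0] and [n %% d], both equal to [x],
   force [n %% d = 0]. *)
have := @nth_uniq _ x _ 0 (n %% d) _ _ (uniq_traject_porbit s x).
rewrite size_traject => /(_ d_gt0 (ltn_pmod n d_gt0)).
by rewrite !nth_traject ?ltn_pmod //= srx eqxx /dvdn eq_sym => <-.
Qed.

(** A return time of [x] under [s] is also one of [h x] under [t]. Only the orbit of [x] is
    constrained, because the second digit is semiconjugated only over the fixed first digit. *)
Lemma dvdn_card_porbit_semiconj (T U : finType) (h : T -> U) (s : {perm T})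
    (t : {perm U}) (x : T) :
  (forall i, h ((s ^+ i)%g x) = (t ^+ i)%g (h x)) ->
  #|porbit t (h x)| %| #|porbit s x|.
Proof. by move=> hst; apply: dvdn_card_porbit; rewrite -hst permX iter_porbit. Qed.

Lemma prod_tperm_fibers (T U V : finType) (f : T * U -> V) (x y z : T) (u : U)
    (r : seq U) :
  injective f -> uniq r ->
  (\prod_(v <- r) tperm (f (x, v)) (f (y, v)))%g (f (z, u)) =
    if u \in r then f (tperm x y z, u) else f (z, u).
Proof.
move=> f_inj; elim: r z u => [|v r IHr] z u /=; first by rewrite big_nil perm1.
case/andP=> v_r r_uniq; rewrite big_cons permM in_cons.
have [->|neq_uv] /= := eqVneq u v.
  have fv_inj : injective (fun w => f (w, v)) by move=> w w' /f_inj[].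
  by rewrite -(inj_tperm x y z fv_inj) /= IHr // (negPf v_r).
by rewrite tpermD ?IHr // (inj_eq f_inj) xpair_eqE negb_and [v == u]eq_sym neq_uv
  orbT.
Qed.

(** Each transposition in a factorisation of [s] lifts to [#|U|] disjoint transpositions, one for
    each value of the untouched coordinate. *)
Lemma odd_perm_fibers (T U V : finType) (f : T * U -> V) (s : {perm T})
    (p : {perm V}) :
  bijective f -> (forall x u, p (f (x, u)) = f (s x, u)) ->
  odd_perm p = odd #|U| && odd_perm s.
Proof.
move=> [g fK gK]; have f_inj := can_inj fK.
have [ts -> ts_neq] := prod_tpermP s => ps.
have -> : p = (\prod_(t <- ts) \prod_u tperm (f (t.1, u)) (f (t.2, u)))%g.
  apply/permP=> v; rewrite -(gK v); case: (g v) => x u; rewrite ps.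
  elim: ts x {ts_neq ps} => [|t ts IHts] x; first by rewrite !big_nil !perm1.
  rewrite !big_cons !permM prod_tperm_fibers ?index_enum_uniq //.
  by rewrite mem_index_enum IHts.
rewrite [in RHS]odd_perm_prod //.
elim: ts ts_neq {ps} => [|t ts IHts] /=.
  by rewrite big_nil odd_perm1 andbF.
case/andP=> t_neq ts_neq; rewrite big_cons odd_permM IHts //.
suff -> : odd_perm (\prod_u tperm (f (t.1, u)) (f (t.2, u)))%g = odd #|U|.
  by case: (odd #|U|).
(* Writing [#|U|] as a sum of ones lets one induction compare it with the product, each factor being
   odd. *)
rewrite -sum1_card; apply: (big_ind2 (fun (q : {perm V}) k => odd_perm q = odd k)).
- exact: odd_perm1.
- by move=> q k q' k' qk qk'; rewrite odd_permM oddD qk qk'.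
by move=> u _; rewrite odd_tperm (inj_eq f_inj) xpair_eqE eqxx andbT t_neq.
Qed.

Lemma mixed_radix_subproof (m n : nat) (p : 'I_m * 'I_n) :
  p.1 + m * p.2 < m * n.
Proof. case: p => [[a ha] [b hb]] /=; nia. Qed.

Definition mixed_radix (m n : nat) (p : 'I_m * 'I_n) : 'I_(m * n) :=
  Ordinal (mixed_radix_subproof p).

Lemma mixed_radix_bij (m n : nat) : bijective (@mixed_radix m n).
Proof.
apply: inj_card_bij; last by rewrite card_prod !card_ord.
move=> [a b] [a' b'] /(congr1 val) /= eq_ab.
have m_gt0 : 0 < m by apply: leq_ltn_trans (ltn_ord a).
have eq_a : a = a' :> nat.
  move: (congr1 (modn^~ m) eq_ab).
  by rewrite -(modnDmr a) -(modnDmr a') !modnMr !addn0 !modn_small.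
by congr pair; apply: val_inj => //=; move: eq_ab m_gt0; rewrite eq_a; nia.
Qed.

(** A carry occurs exactly at the last digit [a = m - 1]; overflow of the second digit is absorbed
    by reduction modulo [m * n]. *)
Lemma cyc_mixed_radix (m n : nat) (a : 'I_m) (b : 'I_n) :
  cyc (m * n) (mixed_radix (a, b)) =
  mixed_radix (cyc m a, (cyc n ^+ (a.+1 == m))%g b).
Proof.
apply: val_inj; rewrite permE [in RHS]/= permE /=.
have [a1_m|a1_m] := eqVneq a.+1 m.
  rewrite permE /= -addSn a1_m -mulnS modnn add0n -muln_modr //.
rewrite perm1 -addSn [a.+1 %% m]modn_small ?modn_small //; last first.
  have := ltn_ord a; lia.
have: a.+1 < m by have := ltn_ord a; lia.
by move=> am; apply: (mixed_radix_subproof (Ordinal am, b)).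
Qed.

(** Here [k] counts the carries met in [j] steps. It is chosen before [b], so a whole fibre
    undergoes one translation. *)
Lemma cycX_mixed_radix (m n j : nat) (a : 'I_m) :
  exists k, forall b : 'I_n,
    (cyc (m * n) ^+ j)%g (mixed_radix (a, b)) =
    mixed_radix ((cyc m ^+ j)%g a, (cyc n ^+ k)%g b).
Proof.
elim: j => [|j [k IHj]]; first by exists 0 => b; rewrite !perm1.
exists (k + (((cyc m ^+ j)%g a).+1 == m)) => b.
by rewrite !expgSr !permM IHj cyc_mixed_radix expgD permM.
Qed.

Lemma witness_type_cycX (m : nat) (pi : 'S_m) (k : nat) :
  witness_type pi ->
  exists x : 'I_m,
    [/\ (cyc m ^+ k * pi)%g x = x,
       forall y : 'I_m, (cyc m ^+ k * pi)%g y = y -> y = x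
     & forall y : 'I_m, y != x -> ~~ odd #|porbit (cyc m ^+ k * pi)%g y|].
Proof. by apply; rewrite mem_rcoset mulgK mem_cycle. Qed.

Lemma witness_type_mixed_radix (m n : nat) (sigma : 'S_m) (gamma : 'S_n)
    (pi : 'S_(m * n)) :
  (forall a b, pi (mixed_radix (a, b)) = mixed_radix (sigma a, gamma b)) ->
  witness_type sigma -> witness_type gamma -> witness_type pi.
Proof.
move=> piE wsigma wgamma tau; rewrite mem_rcoset => /cycleP[j].
move/(canRL (mulgKV pi)) => ->.
set t := (_ * pi)%g; have [a0 [a0_fix a0_uniq a0_odd]] := witness_type_cycX j wsigma.
set t1 := (_ * sigma)%g in a0_fix a0_uniq a0_odd.
have tE a : exists k, forall b,
    t (mixed_radix (a, b)) = mixed_radix (t1 a, (cyc n ^+ k * gamma)%g b).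
  by have [k kE] := cycX_mixed_radix n j a; exists k => b; rewrite !permM kE piE.
have [k tE0] := tE a0; rewrite a0_fix in tE0.
have [b0 [b0_fix b0_uniq b0_odd]] := witness_type_cycX k wgamma.
set t2 := (_ * gamma)%g in tE0 b0_fix b0_uniq b0_odd.
have [digits radixK digitsK] := mixed_radix_bij m n.
clearbody t t1 t2.
have not_odd_dvd d e : d %| e -> ~~ odd d -> ~~ odd e.
  by move=> /dvdnP[q ->]; rewrite oddM negb_and orbC => ->.
exists (mixed_radix (a0, b0)); split=> [|y|y]; first by rewrite tE0 b0_fix.
  rewrite -(digitsK y); case: (digits y) => a b ty.
  have eq_a : a = a0.
    by have [l tEa] := tE a; move: ty; rewrite tEa => /(can_inj radixK)[/a0_uniq].
  by move: ty; rewrite eq_a tE0 => /(can_inj radixK)[/b0_uniq ->].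
rewrite -(digitsK y); case: (digits y) => a b; rewrite (can_eq radixK) xpair_eqE.
have [-> /= neq_b | neq_a _] := eqVneq a a0.
  apply: not_odd_dvd (b0_odd _ neq_b).
  set z := mixed_radix _; have -> : b = (snd \o digits) z by rewrite /= radixK.
  apply: dvdn_card_porbit_semiconj => i /=.
  (* As [a0] is fixed by [t1], the orbit never leaves the fibre over [a0], where [t] acts as
     [t2]. *)
  suff -> : (t ^+ i)%g z = mixed_radix (a0, (t2 ^+ i)%g b) by rewrite !radixK.
  elim: i => [|i IHi]; first by rewrite !perm1.
  by rewrite !expgSr !permM IHi tE0.
apply: not_odd_dvd (a0_odd _ neq_a).
set z := mixed_radix _; have -> : a = (fst \o digits) z by rewrite /= radixK.
apply: dvdn_card_porbit_semiconj => i /=.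
elim: i => [|i IHi]; first by rewrite !perm1.
rewrite !expgSr !permM -IHi; move: ((t ^+ i)%g z) => w.
rewrite -{1}(digitsK w); case: (digits w) => a' b'.
by have [l ->] := tE a'; rewrite radixK.
Qed.

Theorem theorem5p2 (n1 n2 : nat) (hn1 : 3 <= n1) (hn2 : 3 <= n2)
    (odd_n1 : odd n1) (odd_n2 : odd n2)
    (sigma : 'S_n1) (gamma : 'S_n2)
    (hsigma : witness_type sigma) (hgamma : witness_type gamma) :
  exists pi : 'S_(n1 * n2),
    witness_type pi /\ sgn pi = (sgn sigma * sgn gamma)%R.
Proof.
have [digits radixK digitsK] := mixed_radix_bij n1 n2.
pose act (s : 'S_n1) (g : 'S_n2) x :=
  mixed_radix (s (digits x).1, g (digits x).2).
have act_inj s g : injective (act s g).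
  move=> x y /(can_inj radixK)[/perm_inj eq1 /perm_inj eq2].
  by rewrite -(digitsK x) -(digitsK y) (surjective_pairing (digits x)) eq1 eq2
    -surjective_pairing.
have actE s g a b :
    perm (act_inj s g) (mixed_radix (a, b)) = mixed_radix (s a, g b).
  by rewrite permE /act radixK.
(* Moving one digit at a time makes each factor a fibrewise copy of [sigma] or [gamma], whose parity
   [odd_perm_fibers] gives. *)
exists (perm (act_inj sigma 1%g) * perm (act_inj 1%g gamma))%g; split.
  by apply: witness_type_mixed_radix hsigma hgamma => a b; rewrite permM !actE !perm1.
rewrite /sgn odd_permM GRing.signr_addb.
congr (_ ^+ _ * _ ^+ _)%R; congr nat_of_bool.
  rewrite (@odd_perm_fibers _ _ _ (@mixed_radix n1 n2) sigma) ?card_ord ?odd_n2 //.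
    exact: mixed_radix_bij.
  by move=> a b; rewrite actE perm1.
(* The digits are swapped so that [gamma] acts on the first coordinate, with an odd number [n1] of
   copies. *)
rewrite (@odd_perm_fibers _ _ _ (fun p : 'I_n2 * 'I_n1 => mixed_radix (p.2, p.1)) gamma)
  ?card_ord ?odd_n1 //.
  exists (fun x => ((digits x).2, (digits x).1)) => [[b a]|x]; first by rewrite radixK.
  by rewrite -surjective_pairing digitsK.
by move=> b a; rewrite actE perm1.
Qed.
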